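(* Let $k$ be a field of characteristic zero and $R=k[x_1,\ldots,x_n]$. If $\mathbf{f}=\{f_1,\ldots,f_m\}\subset R$ is a polymatroidal set of monomials of degree $2$, then $\mathbf{f}$ is polarizable.
   Context: A set $\mathbf{f}$ of monomials of the same degree is polymatroidal if it satisfies the exchange property: for all $u,v\in\mathbf{f}$ and every $i$ with $\deg_{x_i}(u)>\deg_{x_i}(v)$ there is a $j$ with $\deg_{x_j}(u)<\deg_{x_j}(v)$ such that $x_j u/x_i\in\mathbf{f}$. Polarizability. Let $P\subset k[T_1,\ldots,T_m]$ be the kernel of the $k$-algebra map $k[T_1,\ldots,T_m]\to R$, $T_j\mapsto f_j$. Put $\mathcal{Z}=\{(r_1,\ldots,r_m)\in R^m : \sum_{j} r_j\,\partial f_j/\partial x_i=0 \text{ for all } i=1,\ldots,n\}$, and let $\mathcal{P}\subset\mathcal{Z}$ be the $R$-submodule generated by the vectors $\left(\frac{\partial F}{\partial T_1}(\mathbf{f}),\ldots,\frac{\partial F}{\partial T_m}(\mathbf{f})\right)$, $F\in P$. The set $\mathbf{f}$ is polarizable if $\mathcal{P}=\mathcal{Z}$. *)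

(* Defs.v *)
From mathcomp Require Import all_boot all_order all_algebra.
From mathcomp.multinomials Require Import mpoly.

Set Implicit Arguments.
Unset Strict Implicit.
Unset Printing Implicit Defensive.

Import GRing.Theory.
Local Open Scope ring_scope.

(* A monomial of k[x_1, ..., x_n] is represented by its exponent vector
   u : 'X_{1..n}, so that u i is the degree of u in x_i.  The truncated
   subtraction of U_(i) is harmless because u i > v i forces u i > 0. *)
Definition polymatroidal (n : nat) (B : seq 'X_{1..n}) : Prop :=
  (forall u v : 'X_{1..n}, u \in B -> v \in B -> mdeg u = mdeg v) /\
  (forall u v : 'X_{1..n}, u \in B -> v \in B ->
     forall i : 'I_n, (v i < u i)%N ->
     exists2 j : 'I_n, (u j < v j)%N & (u + U_(j) - U_(i))%MM \in B).

Definition generated_submodule (A : nzRingType) (V : lmodType A)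
    (S : V -> Prop) (v : V) : Prop :=
  exists (N : nat) (c : 'I_N -> A) (w : 'I_N -> V),
    (forall l, S (w l)) /\ v = \sum_(l < N) c l *: w l.

Section Polarizable.

Variables (k : fieldType) (n m : nat) (f : m.-tuple {mpoly k[n]}).

(* F \mPo f is the image of F under the k-algebra map T_j |-> f_j. *)
Definition presentation_ideal (F : {mpoly k[m]}) : Prop := F \mPo f = 0.

Definition differential_syzygy (r : 'rV[{mpoly k[n]}]_m) : Prop :=
  forall i : 'I_n, \sum_(j < m) r 0 j * (tnth f j)^`M(i) = 0.

Definition polar_vector (F : {mpoly k[m]}) : 'rV[{mpoly k[n]}]_m :=
  \row_(j < m) (F^`M(j) \mPo f).

Definition polar_syzygy : 'rV[{mpoly k[n]}]_m -> Prop :=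
  generated_submodule
    (fun w => exists2 F, presentation_ideal F & w = polar_vector F).

Definition polarizable : Prop :=
  forall r : 'rV[{mpoly k[n]}]_m, polar_syzygy r <-> differential_syzygy r.

End Polarizable.

(* Main.v *)
Require Import Defs.
From mathcomp Require Import all_boot all_order all_algebra.
From mathcomp Require Import ring zify.
From mathcomp.multinomials Require Import mpoly.
Import GRing.Theory.
Local Open Scope ring_scope.
Set Implicit Arguments.
Unset Strict Implicit.

(** Polar syzygies are differential syzygies by the chain rule; the content is
    the converse.

    For a monomial [f_j] one has [x_i * df_j/dx_i = (deg_{x_i} f_j) f_j].  So [r]
    is a differential syzygy iff the vector of products [r_j f_j] is killed by
    the matrix of exponents, and this can be tested on each monomial [x^alpha]
    separately.  The component at [x^alpha] is a vector [c] of scalars in the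
    kernel of the exponent matrix, supported on the [f_j] that divide
    [x^alpha], and the syzygy that it contributes is [c_j x^alpha / f_j].

    On the other side, a binomial [T_a T_b - T_c T_d] in the presentation ideal has
    polar vector [v_j x^beta / f_j], where [v = e_a + e_b - e_c - e_d] and
    [x^beta = f_a f_b].  Two facts therefore suffice.

    - The kernel of the exponent matrix of the [f_j] dividing [x^alpha] is
      spanned by the vectors [v] of quadratic relations between these [f_j]
      ([degree_kernel_spanned]).  The [f_j] dividing [x^alpha] again form a
      polymatroidal set, and by duality the claim says that a function on such a
      set which respects quadratic relations is linear in the exponents.
      Viewing quadrics as edges (squares as loops) of a graph, linearity means
      [phi(ab) = w_a + w_b]; the exchange property makes the graph so dense that
      the weights can be read off from one triangle, or one edge if there is no
      triangle ([additive_edge_function]).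

    - If [f_a], [f_b], [f_c], [f_d] all divide [x^alpha] and the relation is not
      trivial, then [x^beta] divides [x^alpha] ([balanced_bound]), so the
      polar vector may be multiplied by [x^(alpha - beta)]. *)

(** * Generated submodules and the chain rule *)

Lemma generated_submodule0 (A : nzRingType) (V : lmodType A) (S : V -> Prop) :
  generated_submodule S 0.
Proof.
exists 0%N, (fun=> 0), (fun=> 0); split=> [[]//|]; by rewrite big_ord0.
Qed.

Lemma generated_submoduleD (A : nzRingType) (V : lmodType A) (S : V -> Prop)
    (x y : V) :
  generated_submodule S x -> generated_submodule S y ->
  generated_submodule S (x + y).
Proof.
move=> [N1 [c1 [w1 [Sw1 ->]]]] [N2 [c2 [w2 [Sw2 ->]]]].
exists (N1 + N2)%N, (fun l => match split l with inl i => c1 i | inr i => c2 i end),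
  (fun l => match split l with inl i => w1 i | inr i => w2 i end).
split=> [l|]; first by case: (split l).
rewrite big_split_ord; congr (_ + _); apply: eq_bigr => i _.
  by rewrite (unsplitK (inl i)).
by rewrite (unsplitK (inr i)).
Qed.

Lemma generated_submodule_sum (A : nzRingType) (V : lmodType A) (S : V -> Prop)
    (I : Type) (s : seq I) (P : pred I) (x : I -> V) :
  (forall i, P i -> generated_submodule S (x i)) ->
  generated_submodule S (\sum_(i <- s | P i) x i).
Proof.
apply: big_ind; [exact: generated_submodule0|exact: generated_submoduleD].
Qed.

Lemma generated_submodule_scaled (A : nzRingType) (V : lmodType A) (S : V -> Prop)
    (a : A) (x : V) :
  S x -> generated_submodule S (a *: x).
Proof.
by move=> Sx; exists 1%N, (fun=> a), (fun=> x); rewrite big_ord1.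
Qed.

Lemma mderiv_comp_mpoly (n m : nat) (k : comNzRingType) (f : m.-tuple {mpoly k[n]})
    (F : {mpoly k[m]}) (i : 'I_n) :
  (F \mPo f)^`M(i) = \sum_(j < m) (F^`M(j) \mPo f) * (tnth f j)^`M(i).
Proof.
(* The identity is a derivation law in F, so it passes to products and then
   from the variables to all monomials. *)
pose chain F := (F \mPo f)^`M(i) = \sum_(j < m) (F^`M(j) \mPo f) * (tnth f j)^`M(i).
have chainM G H : chain G -> chain H -> chain (G * H).
  rewrite /chain rmorphM mderivM => -> ->.
  rewrite mulr_suml mulr_sumr -big_split; apply: eq_bigr => j _ /=.
  rewrite mderivM rmorphD !rmorphM /=; ring.
have chain1 : chain 1.
  rewrite /chain rmorph1 -mpolyC1 mderivC big1 // => j _.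
  by rewrite mderivC raddf0 mul0r.
have chainX j : chain 'X_j.
  rewrite /chain comp_mpolyXU -tnth_nth (bigD1 j) //= big1 => [|l ne_lj].
    by rewrite mderivX mnm1E eqxx scale1r -{1}[U_(j)%MM]add0m addmK mpolyX0
      rmorph1 mul1r addr0.
  by rewrite mderivX mnm1E eq_sym (negPf ne_lj) scale0r raddf0 mul0r.
elim/mpolyind: F => [|c v F _ _ IH].
  rewrite raddf0 mderiv0 big1 // => j _; by rewrite mderiv0 raddf0 mul0r.
rewrite -/(chain _); have chainXv : chain 'X_[v].
  rewrite mpolyXE_id; apply: (big_ind chain) => // j _.
  by elim: (v j) => [|e IHe]; rewrite ?expr0 // exprS; apply: chainM.
rewrite /chain comp_mpolyD comp_mpolyZ mderivD mderivZ chainXv IH scaler_sumr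
  -big_split.
apply: eq_bigr => j _ /=.
by rewrite mderivD mderivZ comp_mpolyD comp_mpolyZ mulrDl scalerAl.
Qed.

Lemma polar_syzygy_differential (n m : nat) (k : fieldType)
    (f : m.-tuple {mpoly k[n]}) (r : 'rV_m) :
  polar_syzygy f r -> differential_syzygy f r.
Proof.
move=> [N [c [w [Pw ->]]]] i.
under eq_bigr => j _ do rewrite summxE mulr_suml.
rewrite exchange_big big1 // => l _ /=; have [F F0 ->] := Pw l.
under eq_bigr => j _ do rewrite !mxE -mulrA.
by rewrite -mulr_sumr -mderiv_comp_mpoly F0 mderiv0 mulr0.
Qed.

(** * Additive functions on graphs with the exchange property *)

(** The degenerate triangles [p = q] and [p = q = r] are allowed, so that a loop
    counts as a triangle.  The exchange property makes every vertex that has an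
    edge adjacent to an end of each edge, hence to at least two of the labels
    [p], [q], [r]; the values of [phi] on the triangle determine the weights there,
    as 2 is invertible, and additivity makes the resulting weight of any other
    vertex independent of the label used.  Without triangles the two ends of one
    edge [pq] split the other vertices into two sides, and [p] may be given
    weight zero. *)
Lemma additive_edge_function (T : finType) (k : fieldType) (e : rel T)
    (phi : T -> T -> k) (nz2 : 2%:R != 0 :> k)
    (e_sym : ssrbool.symmetric e) (phi_sym : forall a b, phi a b = phi b a)
    (e_exch : forall a b c d, e a b -> e c d -> e c b || e d b)
    (phi_add : forall a b c d, e a b -> e c d -> e a c -> e b d ->
       phi a b + phi c d = phi a c + phi b d) :
  exists w : T -> k, forall a b, e a b -> phi a b = w a + w b.
Proof.
have [/existsP[p /existsP[q /existsP[r /and3P[epq epr eqr]]]]|no_tri] :=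
  boolP [exists p, exists q, exists r, [&& e p q, e p r & e q r]].
  pose wp := (phi p q + phi p r - phi q r) / 2%:R.
  pose wq := (phi p q + phi q r - phi p r) / 2%:R.
  pose wr := (phi p r + phi q r - phi p q) / 2%:R.
  have wpq : phi p q = wp + wq by rewrite /wp /wq; field.
  have wpr : phi p r = wp + wr by rewrite /wp /wr; field.
  have wqr : phi q r = wq + wr by rewrite /wq /wr; field.
  pose w a := if e a p then phi a p - wp else phi a q - wq.
  have eqp : e q p by rewrite e_sym.
  have erp : e r p by rewrite e_sym.
  have erq : e r q by rewrite e_sym.
  have phi_p a : e a p -> phi a p = w a + wp by rewrite /w => ->; rewrite subrK.
  have phi_q a : e a q -> phi a q = w a + wq.
    move=> eaq; rewrite /w; case: ifP => eap; last by rewrite subrK.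
    have := phi_add _ _ _ _ eap eqr eaq epr; rewrite wqr wpr => eq_phi.
    apply: (addIr (wp + wr)); rewrite -eq_phi; ring.
  have phi_r a : e a p || e a q -> e a r -> phi a r = w a + wr.
    case/orP=> [eap|eaq] ear.
      have := phi_add _ _ _ _ eap erq ear epq.
      rewrite (phi_sym r q) phi_p // wqr wpq => eq_phi.
      apply: (addIr (wp + wq)); rewrite -eq_phi; ring.
    have := phi_add _ _ _ _ eaq erp ear eqp.
    rewrite (phi_sym r p) (phi_sym q p) phi_q // wpr wpq => eq_phi.
    apply: (addIr (wp + wq)); rewrite -eq_phi; ring.
  exists w => a b eab.
  have eba : e b a by rewrite e_sym.
  (* An edge ab is compared with an edge xy of the triangle such that a is
     adjacent to x and b to y. *)
  have pair x y wx wy : e x y -> phi x y = wx + wy ->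
      e a x -> phi a x = w a + wx -> e b y -> phi b y = w b + wy ->
      phi a b = w a + w b.
    move=> exy phi_xy eax phi_ax eby phi_by.
    have := phi_add _ _ _ _ eab exy eax eby.
    rewrite phi_xy phi_ax phi_by => eq_phi.
    apply: (addIr (wx + wy)); rewrite eq_phi; ring.
  have nbr x y c d : e x y -> e c d -> e d x || e d y.
    by move=> exy ecd; rewrite !(e_sym d); apply: e_exch ecd exy.
  have apq := nbr _ _ _ _ epq eba; have bpq := nbr _ _ _ _ epq eab.
  have apr := nbr _ _ _ _ epr eba; have bpr := nbr _ _ _ _ epr eab.
  have aqr := nbr _ _ _ _ eqr eba; have bqr := nbr _ _ _ _ eqr eab.
  have phi_ar := phi_r a apq; have phi_br := phi_r b bpq.
  have [eap|neap] := boolP (e a p).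
    have [ebq|nebq] := boolP (e b q).
      apply: (pair p q wp wq) => //; [exact: phi_p | exact: phi_q].
    have ebr : e b r by rewrite (negPf nebq) in bqr.
    by apply: (pair p r wp wr) => //; [exact: phi_p | exact: phi_br].
  have eaq : e a q by rewrite (negPf neap) in apq.
  have [ebp|nebp] := boolP (e b p).
    apply: (pair q p wq wp) => //; last exact: phi_p.
      by rewrite addrC phi_sym.
    exact: phi_q.
  have ebr : e b r by rewrite (negPf nebp) in bpr.
  by apply: (pair q r wq wr) => //; [exact: phi_q | exact: phi_br].
have triF p q r : e p q -> e p r -> e q r -> false.
  move=> epq epr eqr; case/negP: no_tri.
  apply/existsP; exists p; apply/existsP; exists q; apply/existsP; exists r.
  exact/and3P.
have [/existsP[p /existsP[q epq]]|no_edge] :=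
  boolP [exists p, exists q, e p q]; last first.
  exists (fun=> 0) => a b eab; case/negP: no_edge.
  by apply/existsP; exists a; apply/existsP; exists b.
exists (fun a => if e a p then phi a p else phi a q - phi p q) => a b eab.
have eba : e b a by rewrite e_sym.
have eqp : e q p by rewrite e_sym.
have nbr c d : e c d -> e d p || e d q.
  by move=> ecd; rewrite !(e_sym d); apply: e_exch ecd epq.
have [eap|neap] := boolP (e a p).
  have nebp : ~~ e b p by apply/negP => ebp; have := triF _ _ _ eab eap ebp.
  have ebq : e b q by have := nbr _ _ eab; rewrite (negPf nebp).
  rewrite (negPf nebp).
  have := phi_add _ _ _ _ eab epq eap ebq => eq_phi.
  apply: (addIr (phi p q)); rewrite eq_phi; ring.
have eaq : e a q by have := nbr _ _ eba; rewrite (negPf neap).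
have nebq : ~~ e b q by apply/negP => ebq; have := triF _ _ _ eab eaq ebq.
have ebp : e b p by have := nbr _ _ eab; rewrite (negPf nebq) orbF.
rewrite ebp.
have := phi_add _ _ _ _ eab eqp eaq ebp; rewrite (phi_sym q p) => eq_phi.
apply: (addIr (phi p q)); rewrite eq_phi; ring.
Qed.

(** * Polymatroidal sets of quadratic monomials *)

Lemma mdeg2_sum (n : nat) (v : 'X_{1..n}) :
  mdeg v = 2%N -> exists a b, v = (U_(a) + U_(b))%MM.
Proof.
move=> v2; have /existsP[a va] : [exists a, v a != 0%N].
  apply: contraTT isT => /existsPn v0; have : v == 0%MM.
    by apply/eqP/mnmP => i; have := v0 i; rewrite negbK mnm0E => /eqP.
  by rewrite -mdeg_eq0 v2.
have le_av : (U_(a) <= v)%MM by rewrite lep1mP.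
have := v2; rewrite -(submK le_av) mdegD mdeg1 addn1 => -[/eqP/mdeg1P[b /eqP->]].
by exists b, a.
Qed.

(** The exchange of [x_i] for [x_j] in [v] raises only the exponent of [x_j], and
    does so below that of the other monomial, hence stays below [alpha]. *)
Lemma polymatroidal_restrict (n : nat) (B : seq 'X_{1..n}) (alpha : 'X_{1..n}) :
  polymatroidal B -> polymatroidal [seq v <- B | (v <= alpha)%MM].
Proof.
move=> [degB exchB]; split=> v w; rewrite !mem_filter => /andP[le_v Bv] /andP[le_w Bw].
  exact: degB.
move=> i lt_i; have [j lt_j Bj] := exchB v w Bv Bw i lt_i.
exists j => //; rewrite mem_filter Bj andbT.
apply/mnm_lepP => l; rewrite mnmBE mnmDE !mnm1E.
have := mnm_lepP le_v l; have := mnm_lepP le_w l.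
case: (eqVneq j l) => [<-|_] le_wl le_vl; last first.
  by rewrite addn0 (leq_trans (leq_subr _ _)).
by rewrite (leq_trans (leq_subr _ _)) // addn1 (leq_trans lt_j).
Qed.

Lemma polymatroidal_edge_exchange (n : nat) (B : seq 'X_{1..n}) (a b c d : 'I_n) :
  polymatroidal B -> (U_(a) + U_(b))%MM \in B -> (U_(c) + U_(d))%MM \in B ->
  ((U_(c) + U_(b))%MM \in B) || ((U_(d) + U_(b))%MM \in B).
Proof.
move=> [_ exchB] Bab Bcd.
have [<-|ne_ac] := eqVneq a c; first by rewrite Bab.
have [<-|ne_ad] := eqVneq a d; first by rewrite Bab orbT.
have [|j] := exchB _ _ Bab Bcd a.
  by rewrite !mnmDE !mnm1E eqxx !(eq_sym _ a) (negPf ne_ac) (negPf ne_ad).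
have -> : (U_(a) + U_(b) + U_(j) - U_(a) = U_(j) + U_(b))%MM.
  by rewrite -addmA addmC addmK addmC.
rewrite !mnmDE !mnm1E.
case: (eqVneq c j) => [->|_] ; first by move=> _ ->.
case: (eqVneq d j) => [->|_] ; first by move=> _ ->; rewrite orbT.
by rewrite ltn0.
Qed.

Lemma polymatroidal_additive_linear (n : nat) (k : fieldType) (nz2 : 2%:R != 0 :> k)
    (B : seq 'X_{1..n}) (phi : 'X_{1..n} -> k) :
  polymatroidal B -> (forall v, v \in B -> mdeg v = 2%N) ->
  (forall v1 v2 v3 v4, v1 \in B -> v2 \in B -> v3 \in B -> v4 \in B ->
     (v1 + v2 = v3 + v4)%MM -> phi v1 + phi v2 = phi v3 + phi v4) ->
  exists w : 'I_n -> k, forall v, v \in B -> phi v = \sum_(i < n) w i * (v i)%:R.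
Proof.
move=> polyB deg2 phi_add.
pose e a b := (U_(a) + U_(b))%MM \in B.
have [||a b c d|a b c d|w phi_w] :=
  @additive_edge_function _ k e (fun a b => phi (U_(a) + U_(b))%MM) nz2.
- by move=> a b; rewrite /e addmC.
- by move=> a b; rewrite addmC.
- exact: polymatroidal_edge_exchange.
- by move=> *; apply: phi_add => //; apply/mnmP => l; rewrite !mnmDE addnACA.
exists w => v Bv; have [a [b def_v]] := mdeg2_sum (deg2 v Bv).
rewrite def_v in Bv *; rewrite (phi_w _ _ Bv).
have pick l : \sum_(i < n) w i * (U_(l)%MM i)%:R = w l.
  rewrite (bigD1 l) //= mnm1E eqxx mulr1 big1 ?addr0 // => i.
  by rewrite eq_sym mnm1E => /negPf->; rewrite mulr0.
by under eq_bigr => i _ do rewrite mnmDE natrD mulrDr; rewrite big_split /= !pick.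
Qed.

(** * Quadratic relations *)

(** [((a, b), (c, d))] stands for the binomial [T_a T_b - T_c T_d]. *)
Local Notation quad m := (('I_m * 'I_m) * ('I_m * 'I_m))%type.

Definition quadric_move (k : fieldType) (m : nat)
    (q : quad m) (j : 'I_m) : k :=
  (q.1.1 == j)%:R + (q.1.2 == j)%:R - ((q.2.1 == j)%:R + (q.2.2 == j)%:R).

Lemma quadric_move_sum (k : fieldType) (m : nat)
    (q : quad m) (x : 'I_m -> k) :
  \sum_(j < m) quadric_move k q j * x j =
    x q.1.1 + x q.1.2 - (x q.2.1 + x q.2.2).
Proof.
have pick i : \sum_(j < m) (i == j)%:R * x j = x i.
  rewrite (bigD1 i) //= eqxx mul1r big1 ?addr0 // => j.
  by rewrite eq_sym => /negPf->; rewrite mul0r.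
under eq_bigr => j _ do rewrite mulrBl !mulrDl.
by rewrite sumrB !big_split /= !pick.
Qed.

Definition balanced_below (n m : nat) (u : m.-tuple 'X_{1..n}) (alpha : 'X_{1..n})
    (q : quad m) : bool :=
  [&& (tnth u q.1.1 <= alpha)%MM, (tnth u q.1.2 <= alpha)%MM,
      (tnth u q.2.1 <= alpha)%MM, (tnth u q.2.2 <= alpha)%MM &
      (tnth u q.1.1 + tnth u q.1.2 == tnth u q.2.1 + tnth u q.2.2)%MM].

(** A vector lies in the row space of [Q] iff every linear functional that vanishes
    on [Q] (a column of [K = cokermx Q]) vanishes on it.  Here such a functional
    respects quadratic relations, so it is a combination of exponents, and [c]
    is orthogonal to the exponents. *)
Lemma degree_kernel_spanned (n m : nat) (k : fieldType) (nz2 : 2%:R != 0 :> k)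
    (u : m.-tuple 'X_{1..n}) (alpha : 'X_{1..n}) (c : 'I_m -> k) :
  uniq u -> polymatroidal u -> (forall j, mdeg (tnth u j) = 2%N) ->
  (forall j, ~~ (tnth u j <= alpha)%MM -> c j = 0) ->
  (forall i, \sum_(j < m) c j * (tnth u j i)%:R = 0) ->
  exists d : quad m -> k,
    forall j, c j = \sum_(q | balanced_below u alpha q) d q * quadric_move k q j.
Proof.
move=> u_uniq polyu deg2 supp_c deg_c.
pose Q : 'M[k]_(#|{: quad m}|, m) := \matrix_(l, j)
  (if balanced_below u alpha (enum_val l) then quadric_move k (enum_val l) j else 0).
have /submxP[D def_c] : (\row_j c j <= Q)%MS.
  rewrite submxE; move: (cokermx Q) (mulmx_coker Q) => K QK.
  apply/eqP/rowP => l; rewrite !mxE.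
  (* The column l of K as a function of monomials rather than of indices: the
     monomials are distinct, so the sum has one term. *)
  pose phi v := \sum_(j | tnth u j == v) K j l.
  have phiE j : phi (tnth u j) = K j l.
    rewrite /phi (big_pred1 j) // => i /=; rewrite (inj_eq _ i j) //.
    by apply/tuple_uniqP.
  pose B := [seq v <- u | (v <= alpha)%MM].
  have polyB : polymatroidal B by apply: polymatroidal_restrict.
  have degB v : v \in B -> mdeg v = 2%N.
    by rewrite mem_filter => /andP[_ /tnthP[j ->]].
  have [|w phi_w] := polymatroidal_additive_linear nz2 (phi := phi) polyB degB.
    move=> v1 v2 v3 v4; rewrite !mem_filter.
    move=> /andP[le1 /tnthP[j1 def1]] /andP[le2 /tnthP[j2 def2]].
    move=> /andP[le3 /tnthP[j3 def3]] /andP[le4 /tnthP[j4 def4]].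
    move: le1 le2 le3 le4; rewrite {}def1 {}def2 {}def3 {}def4 !phiE.
    move=> le1 le2 le3 le4 eq_sum; pose q : quad m := ((j1, j2), (j3, j4)).
    have bal_q : balanced_below u alpha q by apply/and5P; split=> //; apply/eqP.
    have := congr1 (fun M : 'M_(_, _) => M (enum_rank q) l) QK.
    rewrite !mxE; under eq_bigr => j _ do rewrite mxE enum_rankK bal_q.
    by rewrite quadric_move_sum => /eqP; rewrite subr_eq0 => /eqP.
  transitivity (\sum_(j < m) \sum_(i < n) w i * (c j * (tnth u j i)%:R)).
    apply: eq_bigr => j _; rewrite mxE.
    have [le_j|nle_j] := boolP (tnth u j <= alpha)%MM; last first.
      by rewrite supp_c // mul0r big1 // => i _; rewrite mul0r mulr0.
    rewrite -phiE phi_w ?mem_filter ?le_j ?mem_tnth // mulr_sumr.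
    by apply: eq_bigr => i _; rewrite mulrCA.
  by rewrite exchange_big big1 // => i _ /=; rewrite -mulr_sumr deg_c mulr0.
exists (fun q => D 0 (enum_rank q)) => j.
have := congr1 (fun M : 'rV_m => M 0 j) def_c; rewrite !mxE => ->.
rewrite [RHS]big_mkcond (reindex_onto enum_rank enum_val) => [|l _].
  2: exact: enum_valK.
apply: eq_big => [q|q _]; rewrite /= ?enum_rankK ?eqxx // mxE enum_rankK.
by case: ifP => _; rewrite ?mulr0.
Qed.

(** If the exponent of [x_i] in the common product exceeds [alpha i], then [x_i]
    divides all four quadrics, since otherwise a single factor would carry that
    exponent.  Cancelling [x_i] leaves an equality of products of two variables,
    so the relation is trivial. *)
Lemma balanced_bound (n m : nat) (k : fieldType) (u : m.-tuple 'X_{1..n})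
    (alpha : 'X_{1..n}) (q : quad m) :
  uniq u -> (forall j, mdeg (tnth u j) = 2%N) -> balanced_below u alpha q ->
  (tnth u q.1.1 + tnth u q.1.2 <= alpha)%MM \/ quadric_move k q =1 fun=> 0.
Proof.
move=> /tuple_uniqP u_inj deg2 /and5P[le1 le2 le3 le4 /eqP eq_sum].
have [le_sum|/forallPn[i]] := boolP (tnth u q.1.1 + tnth u q.1.2 <= alpha)%MM.
  by left.
rewrite -ltnNge => lt_i; right.
have through v w : (v + w = tnth u q.1.1 + tnth u q.1.2)%MM ->
    (w <= alpha)%MM -> mdeg v = 2%N -> exists a, v = (U_(i) + U_(a))%MM.
  move=> eq_vw le_w deg_v.
  have le_iv : (U_(i) <= v)%MM.
    rewrite lep1mP; apply/eqP => vi0.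
    by move: lt_i; rewrite -eq_vw mnmDE vi0 add0n ltnNge (mnm_lepP le_w).
  have := deg_v; rewrite -(submK le_iv) mdegD mdeg1 addn1 => -[/eqP/mdeg1P[a /eqP->]].
  by exists a; rewrite addmC.
have [a def1] := through _ _ erefl le2 (deg2 _).
have [b def2] := through _ _ (addmC _ _) le1 (deg2 _).
have [c def3] := through _ _ (esym eq_sum) le4 (deg2 _).
have [d def4] := through _ _ (etrans (addmC _ _) (esym eq_sum)) le3 (deg2 _).
have /mnmP eq_U : (U_(a) + U_(b) = U_(c) + U_(d))%MM.
  move: eq_sum; rewrite def1 def2 def3 def4 => /mnmP eqU.
  apply/mnmP => l; have := eqU l; rewrite !mnmDE; lia.
have [eq_ac|ne_ac] := eqVneq a c.
  have eq_bd : b = d.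
    have := eq_U b; rewrite !mnmDE !mnm1E eq_ac eqxx; case: (eqVneq d b) => //; lia.
  have eq13 : q.1.1 = q.2.1 by apply: u_inj; rewrite def1 def3 eq_ac.
  have eq24 : q.1.2 = q.2.2 by apply: u_inj; rewrite def2 def4 eq_bd.
  by move=> j; rewrite /quadric_move eq13 eq24 subrr.
have eq_ad : a = d.
  have := eq_U a; rewrite !mnmDE !mnm1E eqxx (eq_sym c) (negPf ne_ac).
  case: (eqVneq d a) => //; lia.
have eq_bc : b = c.
  have := eq_U c; rewrite !mnmDE !mnm1E eqxx (negPf ne_ac).
  case: (eqVneq b c) => //; lia.
have eq14 : q.1.1 = q.2.2 by apply: u_inj; rewrite def1 def4 eq_ad.
have eq23 : q.1.2 = q.2.1 by apply: u_inj; rewrite def2 def3 eq_bc.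
by move=> j; rewrite /quadric_move eq14 eq23 [X in X - _]addrC subrr.
Qed.

Definition quadric_binomial (k : fieldType) (m : nat)
    (q : quad m) : {mpoly k[m]} :=
  'X_(q.1.1) * 'X_(q.1.2) - 'X_(q.2.1) * 'X_(q.2.2).

(** Multiplying the [j]-th coordinate by [f_j] avoids dividing by monomials: by
    the product rule [T_j d(T_a T_b)/dT_j] is [T_a T_b] times the number of
    occurrences of [j] among [a], [b]. *)
Lemma polar_vector_quadric (n m : nat) (k : fieldType) (u : m.-tuple 'X_{1..n})
    (q : quad m)
    (f := [tuple ('X_[tnth u j] : {mpoly k[n]}) | j < m])
    (beta := (tnth u q.1.1 + tnth u q.1.2)%MM) :
  beta = (tnth u q.2.1 + tnth u q.2.2)%MM ->
  presentation_ideal f (quadric_binomial k q) /\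
  forall j, polar_vector f (quadric_binomial k q) 0 j * 'X_[tnth u j] =
            quadric_move k q j *: 'X_[beta].
Proof.
move=> eq_beta; have compX l : 'X_l \mPo f = 'X_[tnth u l].
  by rewrite comp_mpolyXU -tnth_nth tnth_mktuple.
split=> [|j].
  rewrite /presentation_ideal /quadric_binomial rmorphB !rmorphM /= !compX -!mpolyXD.
  by rewrite -eq_beta subrr.
have derX l : ('X_l : {mpoly k[m]})^`M(j) = (l == j)%:R%:MP.
  rewrite mderivX mnm1E; case: (eqVneq l j) => [->|_]; last by rewrite scale0r mpolyC0.
  by rewrite scale1r -{1}[U_(j)%MM]add0m addmK mpolyX0 mpolyC1.
have leibniz l1 l2 : (('X_l1 * 'X_l2)^`M(j) \mPo f) * 'X_[tnth u j] =
    ((l1 == j)%:R + (l2 == j)%:R) *: 'X_[tnth u l1 + tnth u l2].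
  rewrite mderivM rmorphD !rmorphM /= !derX !comp_mpolyC !compX !mpolyXD.
  rewrite -!mul_mpolyC mpolyCD.
  case: (eqVneq l1 j) => [->|_]; case: (eqVneq l2 j) => [->|_] /=;
    rewrite ?mpolyC1 ?mpolyC0; ring.
rewrite mxE /quadric_binomial mderivB rmorphB mulrBl !leibniz -eq_beta.
by rewrite -scalerBl.
Qed.

(** * Polarization, one multidegree at a time *)

Lemma mcoeffMX_eq0 (n : nat) (k : nzRingType) (p : {mpoly k[n]})
    (v alpha : 'X_{1..n}) : ~~ (v <= alpha)%MM -> (p * 'X_[v])@_alpha = 0.
Proof.
move=> nle; apply: memN_msupp_eq0; rewrite (perm_mem (msuppMX p v)).
by apply: contra nle => /mapP[w _ ->]; apply: lem_addr.
Qed.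

(** These vectors are the homogeneous components of differential syzygies.  The
    junk value of the truncated subtraction when [f_j] does not divide [x^alpha] is multiplied by [c j = 0]. *)
Lemma graded_syzygy_polar (n m : nat) (k : fieldType) (nz2 : 2%:R != 0 :> k)
    (u : m.-tuple 'X_{1..n}) (alpha : 'X_{1..n}) (c : 'I_m -> k) :
  uniq u -> polymatroidal u -> (forall j, mdeg (tnth u j) = 2%N) ->
  (forall j, ~~ (tnth u j <= alpha)%MM -> c j = 0) ->
  (forall i, \sum_(j < m) c j * (tnth u j i)%:R = 0) ->
  polar_syzygy [tuple ('X_[tnth u j] : {mpoly k[n]}) | j < m]
    (\row_j (c j *: 'X_[alpha - tnth u j])).
Proof.
set f := mktuple _ => u_uniq polyu deg2 supp_c deg_c.
have [d def_c] := degree_kernel_spanned nz2 u_uniq polyu deg2 supp_c deg_c.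
pose beta (q : quad m) := (tnth u q.1.1 + tnth u q.1.2)%MM.
have -> : \row_j (c j *: 'X_[alpha - tnth u j]) = \sum_(q | balanced_below u alpha q)
    (d q *: 'X_[alpha - beta q]) *: polar_vector f (quadric_binomial k q).
  apply/rowP => j; rewrite summxE mxE.
  have nzX : ('X_[tnth u j] : {mpoly k[n]}) != 0 by rewrite -msize_poly_eq0 msizeX.
  apply: (mulIf nzX); rewrite mulr_suml.
  have -> : c j *: 'X_[alpha - tnth u j] * 'X_[tnth u j] = c j *: 'X_[alpha].
    rewrite -scalerAl -mpolyXD.
    have [le_j|nle_j] := boolP (tnth u j <= alpha)%MM; first by rewrite submK.
    by rewrite supp_c // !scale0r.
  rewrite def_c scaler_suml; apply: eq_bigr => q bal_q.
  have /and5P[_ _ _ _ /eqP eq_beta] := bal_q.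
  have [_ polar_q] := polar_vector_quadric k eq_beta.
  rewrite mxE -mulrA polar_q -scalerAl -scalerAr -mpolyXD scalerA.
  have [le_beta|->] := balanced_bound k u_uniq deg2 bal_q; first by rewrite submK.
  by rewrite mulr0 !scale0r.
apply: generated_submodule_sum => q /and5P[_ _ _ _ /eqP eq_beta].
apply: generated_submodule_scaled; exists (quadric_binomial k q) => //.
by have [] := polar_vector_quadric k eq_beta.
Qed.

Theorem corollary5p19 (k : fieldType) (n m : nat) (u : m.-tuple 'X_{1..n})
    (char0 : [pchar k] =i pred0)
    (u_uniq : uniq u)
    (u_polymatroidal : polymatroidal u)
    (u_deg2 : forall j : 'I_m, mdeg (tnth u j) = 2%N) :
  polarizable [tuple ('X_[tnth u j] : {mpoly k[n]}) | j < m].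
Proof.
move=> r; split; first exact: polar_syzygy_differential.
set f := mktuple _ => syz_r.
have nz2 : 2%:R != 0 :> k by move/pcharf0P: char0 => ->.
(* Euler's identity: multiplying the i-th equation by x_i turns the derivative
   of a monomial into its exponent in x_i. *)
pose s j := r 0 j * 'X_[tnth u j].
have euler i : \sum_(j < m) (tnth u j i)%:R *: s j = 0.
  transitivity ((\sum_(j < m) r 0 j * (tnth f j)^`M(i)) * 'X_i); last first.
    by rewrite syz_r mul0r.
  rewrite mulr_suml; apply: eq_bigr => j _.
  rewrite /f tnth_mktuple mderivX -scalerAr -scalerAl -mulrA -mpolyXD.
  have [->|nz_i] := eqVneq (tnth u j i) 0%N; first by rewrite !scale0r.
  by rewrite submK // lep1mP.
pose K := (\max_(j < m) msize (s j))%N.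
have -> : r = \sum_(alpha : 'X_{1..n < K})
    \row_j ((s j)@_alpha *: 'X_[alpha - tnth u j]).
  apply/rowP => j; rewrite summxE.
  have nzX : ('X_[tnth u j] : {mpoly k[n]}) != 0 by rewrite -msize_poly_eq0 msizeX.
  apply: (mulIf nzX); rewrite -/(s j) mulr_suml.
  rewrite {1}(@mpolywE _ _ K (s j)) ?leq_bigmax //.
  apply: eq_bigr => alpha _; rewrite mxE -scalerAl -mpolyXD.
  have [le_j|nle_j] := boolP (tnth u j <= alpha)%MM; first by rewrite submK.
  by rewrite mcoeffMX_eq0 // !scale0r.
apply: generated_submodule_sum => alpha _.
apply: graded_syzygy_polar => // [j|i].
  exact: mcoeffMX_eq0.
transitivity ((\sum_(j < m) (tnth u j i)%:R *: s j)@_alpha); last first.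
  by rewrite euler mcoeff0.
by rewrite raddf_sum; apply: eq_bigr => j _; rewrite /= mcoeffZ mulrC.
Qed.
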